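(* For all $n\geq 2$, the number $d_n(321)$ of desarrangements of length $n$ avoiding the pattern $321$ equals the Catalan number $C_{n-1}=\frac{1}{n}\binom{2n-2}{n-1}$.
   Context: Permutations are in one-line notation. An index $i\in[n-1]$ is a descent of $\pi\in\mathfrak{S}_n$ if $\pi_i>\pi_{i+1}$; $i\in[n]$ is an ascent if it is not a descent (so $n$ is always an ascent). A desarrangement is a permutation whose first ascent is even. For a set $\Pi$ of patterns, $d_n(\Pi)$ is the number of desarrangements in $\mathfrak{S}_n$ avoiding every pattern in $\Pi$, where $\pi$ avoids $\sigma$ if no subsequence of $\pi$ has the same relative order as $\sigma$. *)

(* Defs.v *)
From mathcomp Require Import all_boot all_order all_fingroup all_algebra.

Set Implicit Arguments.
Unset Strict Implicit.
Unset Printing Implicit Defensive.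

(* A permutation in S_n is s : 'S_n. Positions and values are 0-based, so the
   index i of [n] is the ordinal of value i - 1. *)

Definition descent n (s : 'S_n) (i : 'I_n) : bool :=
  [exists j : 'I_n, (j == i.+1 :> nat) && (s j < s i)].

(* The last position has no successor, hence is always an ascent. *)
Definition ascent n (s : 'S_n) (i : 'I_n) : bool := ~~ descent s i.

Definition first_ascent n (s : 'S_n) (i : 'I_n) : bool :=
  ascent s i && [forall j : 'I_n, (j < i) ==> ~~ ascent s j].

(* The parity is that of the 1-based index i.+1. *)
Definition desarrangement n (s : 'S_n) : bool :=
  [exists i : 'I_n, first_ascent s i && ~~ odd i.+1].

Definition contains n k (s : 'S_n) (p : 'S_k) : bool :=
  [exists f : {ffun 'I_k -> 'I_n},
     [forall a : 'I_k, forall b : 'I_k, (a < b) ==> (f a < f b)] &&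
     [forall a : 'I_k, forall b : 'I_k, (s (f a) < s (f b)) == (p a < p b)]].

Definition avoids n k (s : 'S_n) (p : 'S_k) : bool := ~~ contains s p.

(* Patterns, possibly of different lengths. *)
Definition pattern : Type := {k : nat & 'S_k}.

Definition d (n : nat) (Pi : seq pattern) : nat :=
  #|[set s : 'S_n | desarrangement s
                    & all (fun p : pattern => avoids s (projT2 p)) Pi]|.

Definition perm321 : 'S_3 := perm (@rev_ord_inj 3).

Definition pat321 : pattern := existT (fun k => 'S_k) 3 perm321.

Lemma perm321_one_line : [seq (perm321 i).+1 | i <- enum 'I_3] = [:: 3; 2; 1].
Proof.
transitivity [seq (3 - i.+1).+1 | i <- map val (enum 'I_3)].
  by rewrite -map_comp; apply: eq_map => i /=; rewrite permE.
by rewrite val_enum_ord.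
Qed.

(* Main.v *)
Require Import Defs.
From mathcomp Require Import all_boot all_order all_fingroup all_algebra.
From mathcomp Require Import zify.

Import GRing.Theory.

(** A 321-avoiding permutation is a desarrangement exactly when it starts with
    a descent. Prepending a first letter [a] to [s] creates no 321 exactly when
    [s] avoids 321 and the values of [s] below [a] occur in increasing order.
    Hence the numbers [f n k] of 321-avoiding [s] in S_n whose [k] smallest
    values occur in increasing order satisfy
    [f (n+1) (k+1) = sum_(k <= a <= n) f n a], the ballot recursion solved by
    [f n k = 'C(2n-k, n) - 'C(2n-k, n+1)]; in particular [f n 0] is the n-th
    Catalan number. A 321-avoiding permutation starts with a descent exactly
    when its second letter is the minimum; peeling off the first two letters
    gives [sum_(a <= n) f n a = f (n+1) 0] such permutations in S_(n+2). *)

Definition avoids321 {n} (s : 'S_n) : bool :=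
  [forall i : 'I_n, forall j : 'I_n, forall l : 'I_n,
     (i < j < l) ==> ~~ (s l < s j < s i)].

Definition small_increasing k {n} (s : 'S_n) : bool :=
  [forall i : 'I_n, forall j : 'I_n,
     [&& i < j, s i < k & s j < k] ==> (s i < s j)].

Definition count321 n k : nat :=
  #|[set s : 'S_n | avoids321 s && small_increasing k s]|.

Lemma avoids321P n (s : 'S_n) :
  reflect (forall i j l : 'I_n, i < j -> j < l -> s l < s j -> s j < s i -> False)
          (avoids321 s).
Proof.
apply: (iffP idP) => [/forallP H i j l ij jl lj ji|H].
  move/forallP: (H i) => /(_ j)/forallP/(_ l)/implyP.
  by rewrite ij jl lj ji => /(_ isT).
apply/forallP=> i; apply/forallP=> j; apply/forallP=> l.
apply/implyP=> /andP[ij jl]; apply/negP=> /andP[lj ji]; exact: (H i j l).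
Qed.

Lemma small_increasingP k n (s : 'S_n) :
  reflect (forall i j : 'I_n, i < j -> s i < k -> s j < k -> s i < s j)
          (small_increasing k s).
Proof.
apply: (iffP idP) => [/forallP H i j ij ik jk|H].
  by move/forallP: (H i) => /(_ j)/implyP; apply; rewrite ij ik jk.
apply/forallP=> i; apply/forallP=> j.
by apply/implyP=> /and3P[ij ik jk]; apply: H.
Qed.

Lemma avoids_pat321E n (s : 'S_n) : avoids s perm321 = avoids321 s.
Proof.
apply/idP/idP => [/negP H|/avoids321P H].
  apply/avoids321P => i j l ij jl lj ji; apply: H.
  apply/existsP; exists [ffun a : 'I_3 => nth i [:: i; j; l] a].
  apply/andP; split; apply/forallP=> -[[|[|[|//]]] ha];
    apply/forallP=> -[[|[|[|//]]] hb]; rewrite !ffunE ?permE /=; lia.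
apply/negP=> /existsP[f /andP[/forallP fmon /forallP fs]].
pose o k (h : k < 3) := Ordinal h.
have mon (a b : 'I_3) : a < b -> f a < f b.
  by move/forallP: (fmon a) => /(_ b)/implyP.
have inv (a b : 'I_3) : b < a -> s (f a) < s (f b).
  move=> ba; move/forallP: (fs a) => /(_ b)/eqP ->.
  by rewrite !permE /=; move: (ltn_ord a) (ltn_ord b); lia.
by apply: (H (f (o 0 isT)) (f (o 1 isT)) (f (o 2 isT))); auto.
Qed.

(** Two descents in a row would form a 321, so after an initial descent the first ascent is at the
    even 1-based index 2. Without one it is at index 1, which is odd. *)
Lemma desarrangement_avoids321E n (s : 'S_n.+2) : avoids321 s ->
  desarrangement s = (s (lift ord0 ord0) < s ord0).
Proof.
move=> /avoids321P H.
have desc0 : descent s ord0 = (s (lift ord0 ord0) < s ord0).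
  apply/existsP/idP => [[j /andP[/eqP j1]]|lt10].
    by rewrite (_ : j = lift ord0 ord0) //; apply/val_inj.
  by exists (lift ord0 ord0); rewrite lt10 andbT.
rewrite -desc0; apply/existsP/idP => [[i /andP[/andP[asc /forallP fst] evi]]|d0].
  have i0 : 0 < i by move: evi; case: (nat_of_ord i).
  by move: (fst ord0); rewrite i0 /ascent negbK.
exists (lift ord0 ord0); rewrite /first_ascent andbT; apply/andP; split.
  apply/negP=> /existsP[l /andP[/eqP l2 ll]].
  by apply: (H ord0 (lift ord0 ord0) l) => //; rewrite ?l2 // -desc0.
apply/forallP=> j; apply/implyP=> /=; rewrite /bump /= => j1.
by rewrite /ascent negbK (_ : j = ord0) //; apply/val_inj => /=; lia.
Qed.

Lemma card_perm_first_value n (P : pred 'S_n.+1) :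
  #|[set s | P s]| = \sum_(a < n.+1) #|[set s : 'S_n | P (lift_perm ord0 a s)]|.
Proof.
pose h (p : 'I_n.+1 * 'S_n) := lift_perm ord0 p.1 p.2.
have h_inj : injective h.
  move=> [a s] [b t] /permP eq_h.
  have ab : a = b by move: (eq_h ord0); rewrite !lift_perm_id.
  rewrite -ab in eq_h *; congr pair; apply/permP=> i.
  by apply: (@lift_inj _ a); move: (eq_h (lift ord0 i)); rewrite !lift_perm_lift.
(* Injectivity suffices, since both sides have (n+1)! elements. *)
have h_bij : bijective h.
  by apply: inj_card_bij => //; rewrite card_prod !card_Sn card_ord factS.
rewrite -sum1dep_card (reindex h) /=; last exact: onW_bij.
rewrite -(pair_big_dep xpredT (fun a s => P (lift_perm ord0 a s)) (fun _ _ => 1)).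
by apply: eq_bigr => a _; rewrite sum1dep_card.
Qed.

Lemma ltn_lift n (a : 'I_n.+1) (i j : 'I_n) : (lift a i < lift a j) = (i < j).
Proof. by rewrite /= /bump; do 2 case: leqP; lia. Qed.

Lemma lift_ltn_pivot n (a : 'I_n.+1) (i : 'I_n) : (lift a i < a) = (i < a).
Proof. by rewrite /= /bump; case: leqP; lia. Qed.

(** A 321 that is not already in [s] uses the new first letter as its 3; its other two letters are
    then an inversion of [s] among values below [a]. *)
Lemma avoids321_lift_perm n (a : 'I_n.+1) (s : 'S_n) :
  avoids321 (lift_perm ord0 a s) = avoids321 s && small_increasing a s.
Proof.
apply/avoids321P/andP => [H|[/avoids321P Hs /small_increasingP Hi] i j l].
  split; [apply/avoids321P => i j l ij jl lj ji|apply/small_increasingP=> i j ij ia ja].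
    apply: (H (lift ord0 i) (lift ord0 j) (lift ord0 l));
      by rewrite ?lift_perm_lift ltn_lift.
  rewrite ltnNge leq_eqVlt; apply/negP=> /orP[/eqP/val_inj/perm_inj eij|ji].
    by rewrite eij ltnn in ij.
  by apply: (H ord0 (lift ord0 i) (lift ord0 j));
    rewrite ?lift_perm_id ?lift_perm_lift ?ltn_lift ?lift_ltn_pivot.
case: (unliftP ord0 j) => [j'|] -> //; case: (unliftP ord0 l) => [l'|] -> //.
rewrite !lift_perm_lift !ltn_lift.
case: (unliftP ord0 i) => [i'|] ->.
  by rewrite !lift_perm_lift !ltn_lift; apply: Hs.
rewrite lift_perm_id lift_ltn_pivot => _ jl lj ja.
by have := Hi _ _ jl ja (ltn_trans lj ja); rewrite ltnNge (ltnW lj).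
Qed.

(** A leading 0 is in order with everything and shifts the other small values down to those below
    [k] in [s]. A nonzero first letter precedes the value 0, so it must not itself be small; the
    small values of [s] are then not shifted. *)
Lemma small_increasing_lift_perm k n (a : 'I_n.+1) (s : 'S_n) :
  small_increasing k.+1 (lift_perm ord0 a s) =
  if a == ord0 then small_increasing k s
  else (k < a) && small_increasing k.+1 s.
Proof.
case: eqP => [->|/eqP a0].
  apply/small_increasingP/small_increasingP => H i j.
    by move: (H (lift ord0 i) (lift ord0 j)); rewrite !lift_perm_lift.
  case: (unliftP ord0 j) => [j'|] -> //.
  case: (unliftP ord0 i) => [i'|] ->; rewrite ?lift_perm_id !lift_perm_lift //.
  exact: H.
have a_gt0 : 0 < a by rewrite lt0n.
apply/small_increasingP/andP => [H|[ka /small_increasingP H] i j].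
  have ka : k < a.
    rewrite ltnNge; apply/negP=> ak.
    (* The second index is the position of the value 0, which is not first because [a] is
       nonzero. *)
    have := H ord0 ((lift_perm ord0 a s)^-1%g ord0).
    rewrite permKV lift_perm_id ltnS ak ltn0 => H0.
    suff: false by []; apply: H0 => //; rewrite lt0n.
    apply/eqP=> /(@val_inj _ _ _ _ ord0) e.
    have := permKV (lift_perm ord0 a s) ord0.
    by rewrite e lift_perm_id => /eqP; apply/negP.
  split=> //; apply/small_increasingP=> i j ij ik jk.
  have := H (lift ord0 i) (lift ord0 j); rewrite !lift_perm_lift !ltn_lift.
  by apply=> //=; rewrite /bump; move: ik jk ka; lia.
case: (unliftP ord0 j) => [j'|] -> //.
case: (unliftP ord0 i) => [i'|] ->; rewrite ?lift_perm_id !lift_perm_lift.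
  rewrite !ltn_lift => ij ik jk; apply: H => //; move: ik jk => /=; rewrite /bump; lia.
by move=> _; rewrite ltnS leqNgt ka.
Qed.

Lemma small_increasing_sub k l n (s : 'S_n) :
  k <= l -> small_increasing l s -> small_increasing k s.
Proof.
move=> kl /small_increasingP H; apply/small_increasingP => i j ij ik jk.
by apply: H => //; apply: leq_trans kl.
Qed.

Lemma small_increasing_le1 k n (s : 'S_n) : k <= 1 -> small_increasing k s.
Proof.
move=> k1; apply/small_increasingP => i j ij ik jk.
have : s i = s j by apply/val_inj => /=; lia.
by move/perm_inj=> e; rewrite e ltnn in ij.
Qed.

Lemma count321_0 n : count321 n 0 = count321 n 1.
Proof. by apply: eq_card => s; rewrite !inE !small_increasing_le1. Qed.

(** First letter 0 yields the summand at [k], first letters from 1 to [k] yield nothing, and a first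
    letter [a > k] yields [count321 n a], as increase below [a] implies increase below [k.+1]. *)
Lemma count321_rec n k : k <= n ->
  count321 n.+1 k.+1 = \sum_(k <= a < n.+1) count321 n a.
Proof.
move=> kn; rewrite /count321 card_perm_first_value.
transitivity (\sum_(a < n.+1)
    (if a == 0 :> nat then count321 n k
     else if k < a then count321 n a else 0)).
  apply: eq_bigr => a _.
  case: eqP => [a0|/eqP a0].
    apply: eq_card => s; rewrite !inE avoids321_lift_perm small_increasing_lift_perm.
    by rewrite -val_eqE /= a0 /= small_increasing_le1 // andbT.
  case: ltnP => ka; last first.
    apply: eq_card0 => s; rewrite !inE small_increasing_lift_perm.
    by rewrite -val_eqE /= (negbTE a0) ltnNge ka /= andbF.
  apply: eq_card => s; rewrite !inE avoids321_lift_perm small_increasing_lift_perm.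
  rewrite -val_eqE /= (negbTE a0) ka /= -andbA; congr (_ && _).
  by case Hs: (small_increasing a s) => //=; apply: small_increasing_sub Hs.
rewrite -(big_mkord xpredT (fun a => if a == 0 then count321 n k
     else if k < a then count321 n a else 0)) big_ltn //= [RHS]big_ltn //.
congr (_ + _); rewrite (big_cat_nat (n := k.+1)) //= big1_seq ?add0n; last first.
  move=> a; rewrite mem_index_iota /= => /andP[a0 ak].
  by rewrite eqn0Ngt a0 /= ltnNge -ltnS ak.
by apply: eq_big_nat => a /andP[ka _]; rewrite ka eqn0Ngt (leq_ltn_trans _ ka).
Qed.

Lemma count321E n k : k <= n ->
  count321 n k + 'C(2 * n - k, n.+1) = 'C(2 * n - k, n).
Proof.
elim: n k => [|n IHn] k kn.
  have -> : k = 0 by lia.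
  rewrite bin0 addn0 /count321; transitivity #|{: 'S_0}|; last by rewrite card_Sn.
  apply: eq_card => s.
  rewrite !inE small_increasing_le1 // andbT; apply/avoids321P; by case.
have recE j : j <= n ->
    count321 n.+1 j.+1 + 'C(2 * n.+1 - j.+1, n.+2) = 'C(2 * n.+1 - j.+1, n.+1).
  move=> jn; rewrite count321_rec //.
  (* Downward induction on [j]: peeling off the first summand leaves the sum for [j.+1], and
     Pascal's rule matches this on both binomials. *)
  have [m] : exists m, n = j + m by exists (n - j); lia.
  elim: m j jn => [|m IHm] j jn nE.
    rewrite addn0 in nE; rewrite -nE big_nat1; have := IHn n (leqnn n).
    have -> : 2 * n - n = n by lia.
    have -> : 2 * n.+1 - n.+1 = n.+1 by lia.
    by rewrite !binn !bin_small.
  have jn' : j.+1 <= n by lia.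
  rewrite big_ltn //; have := IHm j.+1 jn'; rewrite addSnnS => /(_ nE).
  have := IHn j jn.
  have -> : 2 * n.+1 - j.+1 = (2 * n - j).+1 by lia.
  have -> : 2 * n.+1 - j.+2 = 2 * n - j by lia.
  rewrite !binS; lia.
case: k kn => [_|k kn]; last exact: recE.
(* The recursion does not reach column 0, but it equals column 1; after Pascal's rule the two
   formulas agree by the symmetry of row 2n+1. *)
have := recE 0 isT; rewrite count321_0.
have -> : 2 * n.+1 - 0 = (2 * n.+1 - 1).+1 by lia.
rewrite !binS.
have : 'C(2 * n.+1 - 1, n.+1) = 'C(2 * n.+1 - 1, n).
  by rewrite -bin_sub; [congr 'C(_, _)|]; lia.
lia.
Qed.

Lemma count321_0_catalan n : n.+1 * count321 n 0 = 'C(2 * n, n).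
Proof.
(* Here (n+1) C(2n, n+1) = n C(2n, n), so multiplying the difference by n+1 leaves C(2n, n). *)
have := count321E n 0 (leq0n n); have := mul_bin_left (2 * n) n.
rewrite subn0; have -> : 2 * n - n = n by lia.
nia.
Qed.

Lemma d_pat321E n : d n.+2 [:: pat321] = count321 n.+1 0.
Proof.
rewrite count321_0 count321_rec //.
transitivity #|[set s : 'S_n.+2 | avoids321 s && (s (lift ord0 ord0) < s ord0)]|.
  apply: eq_card => s; rewrite !inE /= andbT avoids_pat321E andbC.
  by case Hs: (avoids321 s) => //=; rewrite desarrangement_avoids321E.
rewrite card_perm_first_value big_ord_recl eq_card0 ?add0n; last first.
  by move=> s; rewrite !inE lift_perm_id ltn0 andbF.
rewrite big_mkord; apply: eq_bigr => a _.
(* The first letter is now [a.+1]. A nonzero second letter [b.+1] would need [b < a] for the descent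
   and [a <= b] for avoidance, so only second letter 0 survives. *)
rewrite card_perm_first_value big_ord_recl /= [X in _ + X]big1 ?addn0; last first.
  move=> b _; apply: eq_card0 => s; rewrite !inE avoids321_lift_perm.
  rewrite lift_perm_id lift_perm_lift lift_perm_id lift_ltn_pivot.
  rewrite small_increasing_lift_perm /= /bump /= add1n add1n ltnS.
  by rewrite [b.+1 < _]ltnS; case: (leqP a b) => _ /=; rewrite !andbF.
apply: eq_card => s; rewrite !inE avoids321_lift_perm.
rewrite lift_perm_id lift_perm_lift lift_perm_id lift_ltn_pivot.
rewrite small_increasing_lift_perm /= avoids321_lift_perm.
by rewrite small_increasing_le1 // !andbT.
Qed.

Theorem theorem3p7 (n : nat) (hn : 2 <= n) :
  ((d n [:: pat321])%:R = n%:R^-1 * 'C(2 * n - 2, n - 1)%:R :> rat)%R.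
Proof.
case: n hn => [|[|n]] // _; rewrite d_pat321E.
have -> : 2 * n.+2 - 2 = 2 * n.+1 by lia.
rewrite subn1 /= -count321_0_catalan natrM mulKf //.
by rewrite Num.Theory.pnatr_eq0.
Qed.
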